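(* Let $G$ be a group and $\mathsf V$ a variety of algebras of type $T$. The subcategory $\mathsf A(G,\mathsf V)$ is reflective in $\mathsf{pA}(G,\mathsf V)$.
   Context: A partial action of a group $G$ on a set $A$ is a partial map $\theta:G\times A\dashrightarrow A$ such that for all $x,y\in G$, $a\in A$: (i) $\theta(1,a)$ is defined and equals $a$; (ii) if $\theta(x,a)$ is defined, then $\theta(x^{-1},\theta(x,a))$ is defined and equals $a$; (iii) if $\theta(y,a)$ and $\theta(x,\theta(y,a))$ are defined, then $\theta(xy,a)$ is defined and equals $\theta(x,\theta(y,a))$. It is global if everywhere defined. The domain $D_x$ is $\{\theta(x,a)\mid a\in A,\ \theta(x,a)\text{ defined}\}$, and $\theta_x=\theta(x,-)$ is a bijection $D_{x^{-1}}\to D_x$. A type of algebras is a sequence $T=\{n_\gamma\}_{\gamma<o(T)}$ of non-negative integers indexed by ordinals; algebras of type $T$ are sets with (total) operations $f_\gamma$ of arity $n_\gamma$. The variety $\mathsf V=\mathsf{Al}(T,\Sigma)$ is the class of all algebras of type $T$ satisfying each identity of a given set of identities $\Sigma$, viewed as a full subcategory of the category of algebras of type $T$ and homomorphisms. $\mathsf{pA}(G,\mathsf V)$ is the category of pairs $(\theta,\mathcal A)$ with $\mathcal A\in\mathsf V$ and $\theta$ a partial action of $G$ on the set $A$ such that every $D_x$ is a subalgebra $\mathcal D_x$ of $\mathcal A$ and every $\theta_x:\mathcal D_{x^{-1}}\to\mathcal D_x$ is an isomorphism. Morphisms $(\theta,\mathcal A)\to(\theta',\mathcal A')$ are homomorphisms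 $\varphi:\mathcal A\to\mathcal A'$ such that whenever $\theta(x,a)$ is defined, $\theta'(x,\varphi(a))$ is defined and equals $\varphi(\theta(x,a))$. $\mathsf A(G,\mathsf V)$ is the full subcategory of pairs with global $\theta$. A subcategory $\mathsf D$ of a category $\mathsf C$ is reflective if for any $C\in\mathsf C$ there exist $R\in\mathsf D$ and a morphism $\varepsilon:C\to R$ such that for all $D\in\mathsf D$ and $\varphi:C\to D$ there is a unique $\psi:R\to D$ in $\mathsf D$ with $\psi\circ\varepsilon=\varphi$. *)

(* Defs.v *)
From mathcomp Require Import all_boot.
From mathcomp Require Import boolp.

Set Implicit Arguments.
Unset Strict Implicit.
Unset Printing Implicit Defensive.

(** * Categories and reflective subcategories *)

Record category := Category {
  ob :> Type;
  hom : ob -> ob -> Type;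
  idm : forall X, hom X X;
  compm : forall X Y Z, hom Y Z -> hom X Y -> hom X Z;
  comp1m : forall X Y (f : hom X Y), compm (idm Y) f = f;
  compm1 : forall X Y (f : hom X Y), compm f (idm X) = f;
  compmA : forall X Y Z W (h : hom Z W) (g : hom Y Z) (f : hom X Y),
    compm h (compm g f) = compm (compm h g) f
}.
Arguments hom {c} X Y.
Arguments idm {c} X.
Arguments compm {c X Y Z} g f.

(* Only the values of [sub_hom] between objects satisfying [sub_ob] matter. *)
Record subcategory (C : category) := Subcategory {
  sub_ob : C -> Prop;
  sub_hom : forall X Y : C, hom X Y -> Prop;
  sub_idm : forall X, sub_ob X -> sub_hom (idm X);
  sub_compm : forall X Y Z (g : hom Y Z) (f : hom X Y),
    sub_ob X -> sub_ob Y -> sub_ob Z ->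
    sub_hom g -> sub_hom f -> sub_hom (compm g f)
}.

Definition full_subcategory (C : category) (P : C -> Prop) : subcategory C :=
  @Subcategory C P (fun _ _ _ => True)
    (fun _ _ => I) (fun _ _ _ _ _ _ _ _ _ _ => I).

Definition reflective (C : category) (D : subcategory C) : Prop :=
  forall X : C, exists R : C, sub_ob D R /\
    exists eps : hom X R,
      forall Y : C, sub_ob D Y -> forall phi : hom X Y,
        exists! psi : hom R Y, sub_hom D psi /\ compm psi eps = phi.

(** * Algebras, identities and varieties *)

(* The operation symbols form an arbitrary type; a sequence of arities
   indexed by the ordinals below o(T) is, up to a choice of well-order on the
   symbols (which plays no role for algebras of type T), a family of arities. *)
Record alg_type := AlgType {
  opsym : Type;
  arity : opsym -> nat
}.

Record algebra (T : alg_type) := Algebra {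
  carrier :> Type;
  op : forall s : opsym T, ('I_(arity s) -> carrier) -> carrier
}.

Inductive term (T : alg_type) : Type :=
| Var of nat
| App (s : opsym T) of ('I_(arity s) -> term T).
Arguments Var {T} n.

Fixpoint eval (T : alg_type) (A : algebra T) (v : nat -> A) (t : term T) : A :=
  match t with
  | Var n => v n
  | App s ts => op (fun i => eval v (ts i))
  end.

Definition identity (T : alg_type) : Type := (term T * term T)%type.

Definition satisfies (T : alg_type) (A : algebra T) (e : identity T) : Prop :=
  forall v : nat -> A, eval v e.1 = eval v e.2.

Definition Al (T : alg_type) (Sigma : identity T -> Prop) : algebra T -> Prop :=
  fun A => forall e, Sigma e -> satisfies A e.

Record alg_hom (T : alg_type) (A B : algebra T) := AlgHom {
  alg_fun :> A -> B;
  alg_homP : forall (s : opsym T) (a : 'I_(arity s) -> A),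
    alg_fun (op a) = op (fun i => alg_fun (a i))
}.

Definition is_alg_iso (T : alg_type) (A B : algebra T) (f : alg_hom A B) : Prop :=
  bijective f.

Definition is_subalgebra (T : alg_type) (A : algebra T) (P : A -> Prop) : Prop :=
  forall (s : opsym T) (a : 'I_(arity s) -> A), (forall i, P (a i)) -> P (op a).

Definition subalgebra (T : alg_type) (A : algebra T) (P : A -> Prop)
    (hP : is_subalgebra P) : algebra T :=
  @Algebra T {a : A | P a}
    (fun s a => exist P (op (fun i => sval (a i))) (hP s _ (fun i => svalP (a i)))).

Definition alg_id (T : alg_type) (A : algebra T) : alg_hom A A :=
  @AlgHom T A A id (fun _ _ => erefl).

Lemma alg_comp_homP (T : alg_type) (A B C : algebra T)
    (g : alg_hom B C) (f : alg_hom A B) (s : opsym T) (a : 'I_(arity s) -> A) :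
  g (f (op a)) = op (fun i => g (f (a i))).
Proof. by rewrite !alg_homP. Qed.

Definition alg_comp (T : alg_type) (A B C : algebra T)
    (g : alg_hom B C) (f : alg_hom A B) : alg_hom A C :=
  @AlgHom T A C (fun a => g (f a)) (alg_comp_homP g f).

(** * Partial actions *)

Local Open Scope group_scope.

(* A partial map G x A --> A is a map to [option A]; [theta x a = Some b]
   reads: theta(x, a) is defined and equal to b. *)
Record partial_action (G : groupType) (A : Type) (theta : G -> A -> option A) : Prop := {
  pact1 : forall a, theta 1 a = Some a;
  pactV : forall x a b, theta x a = Some b -> theta x^-1 b = Some a;
  pactM : forall x y a b c,
    theta y a = Some b -> theta x b = Some c -> theta (x * y) a = Some c
}.

Definition global_action (G : groupType) (A : Type) (theta : G -> A -> option A) : Prop :=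
  forall x a, exists b, theta x a = Some b.

Definition pact_dom (G : groupType) (A : Type) (theta : G -> A -> option A) (x : G) :
    A -> Prop :=
  fun b => exists a, theta x a = Some b.

Section PA.
Variables (G : groupType) (T : alg_type) (V : algebra T -> Prop).

Record pa_ob := PaOb {
  pa_alg :> algebra T;
  pa_act : G -> pa_alg -> option pa_alg;
  pa_variety : V pa_alg;
  pa_actP : partial_action pa_act;
  pa_domP : forall x, is_subalgebra (pact_dom pa_act x);
  pa_isoP : forall x,
    exists f : alg_hom (subalgebra (@pa_domP x^-1)) (subalgebra (@pa_domP x)),
      is_alg_iso f /\ forall a, pa_act x (sval a) = Some (sval (f a))
}.

Record pa_hom (X Y : pa_ob) := PaHom {
  pa_fun :> alg_hom X Y;
  pa_homP : forall x a b,
    pa_act x a = Some b -> pa_act x (pa_fun a) = Some (pa_fun b)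
}.

Lemma pa_hom_eq (X Y : pa_ob) (f g : pa_hom X Y) : (forall a, f a = g a) -> f = g.
Proof.
case: f => [[f fop] fP]; case: g => [[g gop] gP] /= /funext fg.
move: fop fP; rewrite fg => fop.
rewrite (Prop_irrelevance fop gop) => fP.
by rewrite (Prop_irrelevance fP gP).
Qed.

Definition pa_id (X : pa_ob) : pa_hom X X :=
  @PaHom X X (alg_id X) (fun _ _ _ e => e).

Definition pa_comp (X Y Z : pa_ob) (g : pa_hom Y Z) (f : pa_hom X Y) : pa_hom X Z :=
  @PaHom X Z (alg_comp g f) (fun _ _ _ e => pa_homP g (pa_homP f e)).

Lemma pa_comp1m (X Y : pa_ob) (f : pa_hom X Y) : pa_comp (pa_id Y) f = f.
Proof. exact: pa_hom_eq. Qed.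

Lemma pa_compm1 (X Y : pa_ob) (f : pa_hom X Y) : pa_comp f (pa_id X) = f.
Proof. exact: pa_hom_eq. Qed.

Lemma pa_compmA (X Y Z W : pa_ob)
    (h : pa_hom Z W) (g : pa_hom Y Z) (f : pa_hom X Y) :
  pa_comp h (pa_comp g f) = pa_comp (pa_comp h g) f.
Proof. exact: pa_hom_eq. Qed.

Definition pA : category := Category pa_comp1m pa_compm1 pa_compmA.

Definition gA : subcategory pA :=
  @full_subcategory pA (fun X : pa_ob => global_action (@pa_act X)).

End PA.

(* Main.v *)
Require Import Defs.
From mathcomp Require Import all_boot.
From mathcomp Require Import boolp.

(** The reflection of a partial action of [G] on [A] is the algebra presented,
    within the variety, by generators [(x, a)], to be thought of as [x] applied
    to [a], for [x] in [G] and [a] in [A], and by the relations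
    - [(x, theta(y, a)) = (x y, a)] whenever [theta(y, a)] is defined, and
    - [f((x, a_1), ..., (x, a_n)) = (x, f(a_1, ..., a_n))] for each operation [f].
    Concretely it is the algebra of words in the generators, modulo the least
    congruence [orbit_rel] that contains these relations and all instances of
    the identities.  Left translation of the first coordinate of the generators
    preserves the relations, so [G] acts on the quotient by endomorphisms: this
    is a global action ([globalization_exists]).  The unit of the reflection is
    [a |-> (1, a)]; the second family of relations (at [x = 1]) makes it a
    homomorphism, the first makes it compatible with the partial actions, since
    [x (1, a) = (x, a) = (1, theta(x, a))].

    A morphism [phi] to a global action must extend to words by
    [(x, a) |-> x phi(a)], which is forced because [(x, a) = x (1, a)]; hence
    uniqueness.  This extension respects the defining relations since [G] acts
    on the target by homomorphisms and [phi] preserves the partial action; as the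
    target lies in the variety, the extension factors through the quotient. *)

Set Implicit Arguments.
Unset Strict Implicit.
Unset Printing Implicit Defensive.

Local Open Scope group_scope.

(** * Quotients of algebras *)

Lemma eval_hom (T : alg_type) (A B : algebra T) (f : alg_hom A B)
    (v : nat -> A) (t : term T) :
  f (eval v t) = eval (fun n => f (v n)) t.
Proof.
elim: t => [//|s ts IH] /=; rewrite alg_homP; congr op.
exact/funext.
Qed.

Record congruence (T : alg_type) (A : algebra T) (r : A -> A -> Prop) : Prop := {
  congr_refl : forall a, r a a;
  congr_sym : forall a b, r a b -> r b a;
  congr_trans : forall a b c, r a b -> r b c -> r a c;
  congr_op : forall (s : opsym T) (a b : 'I_(arity s) -> A),
    (forall i, r (a i) (b i)) -> r (op a) (op b)
}.

(** The carrier is the set of classes, as predicates on [A]; the operations are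
    computed on chosen representatives. *)
Lemma quotient_exists (T : alg_type) (A : algebra T) (r : A -> A -> Prop) :
  congruence r ->
  exists Q : algebra T, exists pi : alg_hom A Q,
    (forall q, exists a, pi a = q) /\ (forall a b, pi a = pi b <-> r a b).
Proof.
move=> rC.
pose Q := {P : A -> Prop | exists a, P = r a}.
pose cls a : Q := exist _ (r a) (ex_intro _ a erefl).
have clsE a b : cls a = cls b <-> r a b.
  split=> [[e]|rab]; first by rewrite e; apply: congr_refl.
  apply: eq_exist; apply: funext => c; apply: propext; split.
    by apply: (congr_trans rC); apply: congr_sym.
  exact: (congr_trans rC).
have clsS q : exists a, cls a = q.
  by case: q => P [a Pa]; exists a; apply: eq_exist.
have [repr reprK] := choice clsS.
pose opQ s (q : 'I_(arity s) -> Q) := cls (op (fun i => repr (q i))).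
have clsP s (a : 'I_(arity s) -> A) : cls (op a) = opQ s (fun i => cls (a i)).
  by apply/clsE/(congr_op rC) => i; apply/clsE; rewrite reprK.
by exists (@Algebra T Q opQ), (@AlgHom T A (@Algebra T Q opQ) cls clsP).
Qed.

Lemma hom_factor (T : alg_type) (A B Q : algebra T)
    (pi : alg_hom A Q) (f : alg_hom A B) :
  (forall q, exists a, pi a = q) ->
  (forall a b, pi a = pi b -> f a = f b) ->
  exists g : alg_hom Q B, forall a, g (pi a) = f a.
Proof.
move=> piS ker_le; have [repr reprK] := choice piS.
pose g q := f (repr q).
have gpi a : g (pi a) = f a by apply: ker_le; rewrite reprK.
have gP s (q : 'I_(arity s) -> Q) : g (op q) = op (fun i => g (q i)).
  have {1}-> : q = fun i => pi (repr (q i)) by apply/funext => i; rewrite reprK.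
  by rewrite -alg_homP gpi alg_homP.
by exists (AlgHom gP).
Qed.

Lemma quotient_satisfies (T : alg_type) (A Q : algebra T) (pi : alg_hom A Q)
    (e : identity T) :
  (forall q, exists a, pi a = q) ->
  (forall v : nat -> A, pi (eval v e.1) = pi (eval v e.2)) ->
  satisfies Q e.
Proof.
move=> piS piE v; have [repr reprK] := choice piS.
have -> : v = fun n => pi (repr (v n)) by apply/funext => n; rewrite reprK.
by rewrite -!eval_hom.
Qed.

(** * Global actions on algebras *)

(** If all [a i] lie in the domain of [theta_x], then so does [op a], because
    that domain is a subalgebra; and [theta_x] is a homomorphism there. *)
Lemma pact_op (G : groupType) (T : alg_type) (V : algebra T -> Prop)
    (X : pa_ob G V) (x : G) (s : opsym T) (a b : 'I_(arity s) -> X) :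
  (forall i, pa_act x (a i) = Some (b i)) -> pa_act x (op a) = Some (op b).
Proof.
move=> ab; have [f [_ fE]] := pa_isoP X x.
have aD i : pact_dom (@pa_act _ _ _ X) x^-1 (a i).
  by exists (b i); apply: (pactV (pa_actP X)).
pose a' i : subalgebra (@pa_domP _ _ _ X x^-1) := exist _ (a i) (aD i).
have := fE (op a'); rewrite alg_homP /= => ->; congr (Some (op _)).
by apply/funext => i; have /= := fE (a' i); rewrite ab => -[].
Qed.

(** Elements outside the domain of the action of [x] are left fixed, so that
    computing in a global target requires no proof of definedness. *)
Definition total_act (G : groupType) (T : alg_type) (V : algebra T -> Prop)
    (Y : pa_ob G V) (x : G) (b : Y) : Y := odflt b (pa_act x b).

Section GlobalTarget.
Variables (G : groupType) (T : alg_type) (V : algebra T -> Prop) (Y : pa_ob G V).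
Hypothesis Yglobal : global_action (@pa_act _ _ _ Y).

Lemma total_actE (x : G) (b : Y) : pa_act x b = Some (total_act x b).
Proof. by rewrite /total_act; have [c ->] := Yglobal x b. Qed.

Lemma total_actM (x y : G) (b : Y) :
  total_act (x * y) b = total_act x (total_act y b).
Proof.
apply: Some_inj; rewrite -total_actE.
by apply: (pactM (pa_actP Y)); apply: total_actE.
Qed.

Lemma total_act_op (x : G) (s : opsym T) (b : 'I_(arity s) -> Y) :
  total_act x (op b) = op (fun i => total_act x (b i)).
Proof.
apply: Some_inj; rewrite -total_actE.
by apply: pact_op => i; apply: total_actE.
Qed.

End GlobalTarget.

Section GlobalObject.
Variables (G : groupType) (T : alg_type) (V : algebra T -> Prop) (Q : algebra T).
Variable act : G -> alg_hom Q Q.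
Hypotheses (VQ : V Q) (act1 : forall q, act 1 q = q).
Hypothesis actM : forall x y q, act (x * y) q = act x (act y q).

Let theta (x : G) (q : Q) := Some (act x q).

Let actKV x q : act x (act x^-1 q) = q. Proof. by rewrite -actM mulgV act1. Qed.

Let actK x q : act x^-1 (act x q) = q. Proof. by rewrite -actM mulVg act1. Qed.

Lemma global_partial_action : partial_action theta.
Proof.
split=> [a|x a b [<-]|x y a b c [<-] [<-]]; rewrite /theta.
- by rewrite act1.
- by rewrite actK.
- by rewrite actM.
Qed.

Let domT x q : pact_dom theta x q.
Proof. by exists (act x^-1 q); rewrite /theta actKV. Qed.

Let domP x : is_subalgebra (pact_dom theta x).
Proof. by move=> s a _; apply: domT. Qed.

Lemma global_iso x :
  exists f : alg_hom (subalgebra (@domP x^-1)) (subalgebra (@domP x)),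
    is_alg_iso f /\ forall a, theta x (sval a) = Some (sval (f a)).
Proof.
pose f (a : subalgebra (@domP x^-1)) : subalgebra (@domP x) :=
  exist _ (act x (sval a)) (domT x _).
have fP s (a : 'I_(arity s) -> subalgebra (@domP x^-1)) :
    f (op a) = op (fun i => f (a i)).
  by apply: eq_exist; rewrite /= alg_homP.
exists (AlgHom fP); split=> //=.
by exists (fun b => exist _ (act x^-1 (sval b)) (domT x^-1 _)) => -[a aD];
  apply: eq_exist => /=.
Qed.

Definition global_ob : pa_ob G V := PaOb VQ global_partial_action global_iso.

Lemma global_ob_global : global_action (@pa_act _ _ _ global_ob).
Proof. by move=> x q; exists (act x q). Qed.

End GlobalObject.

(** * Words in the formal translates of a partial action *)

(** [Gen x a] stands for the formal result of applying [x] to [a]; it is present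
    whether or not [theta(x, a)] is defined. *)
Inductive word (G : groupType) (T : alg_type) (A : Type) : Type :=
| Gen of G & A
| Node (s : opsym T) of ('I_(arity s) -> word G T A).
Arguments Gen {G T A} x a.
Arguments Node {G T A} s ts.

Section Globalization.
Variables (G : groupType) (T : alg_type) (Sigma : identity T -> Prop).
Variable X : pa_ob G (Al Sigma).

Definition word_alg : algebra T := @Algebra T (word G T X) (@Node G T X).

Fixpoint translate (x : G) (t : word_alg) : word_alg :=
  match t with
  | Gen y a => Gen (x * y) a
  | Node s ts => Node s (fun i => translate x (ts i))
  end.

Definition translate_hom (x : G) : alg_hom word_alg word_alg :=
  @AlgHom T word_alg word_alg (translate x) (fun _ _ => erefl).

Lemma translate1 t : translate 1 t = t.
Proof.
elim: t => [y a|s ts IH] /=; first by rewrite mul1g.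
by congr Node; apply/funext.
Qed.

Lemma translateM x y t : translate (x * y) t = translate x (translate y t).
Proof.
elim: t => [z a|s ts IH] /=; first by rewrite mulgA.
by congr Node; apply/funext.
Qed.

Inductive orbit_rel : word_alg -> word_alg -> Prop :=
| Orbit_refl t : orbit_rel t t
| Orbit_sym t u : orbit_rel t u -> orbit_rel u t
| Orbit_trans t u w : orbit_rel t u -> orbit_rel u w -> orbit_rel t w
| Orbit_op s (ts us : 'I_(arity s) -> word_alg) :
    (forall i, orbit_rel (ts i) (us i)) -> orbit_rel (Node s ts) (Node s us)
| Orbit_identity e (v : nat -> word_alg) :
    Sigma e -> orbit_rel (eval v e.1) (eval v e.2)
| Orbit_act x y a b :
    pa_act y a = Some b -> orbit_rel (Gen x b) (Gen (x * y) a)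
| Orbit_gen_op x s (a : 'I_(arity s) -> X) :
    orbit_rel (Node s (fun i => Gen x (a i))) (Gen x (op a)).

Lemma orbit_congruence : congruence orbit_rel.
Proof.
split; [exact: Orbit_refl | exact: Orbit_sym | exact: Orbit_trans | ].
exact: Orbit_op.
Qed.

(** The action descends to the quotient.  The defining relations are stated for
    every first coordinate, not only at [1], so that each of them is carried to
    one of the same form; instances of identities are preserved since translation
    is an endomorphism of the word algebra. *)
Lemma translate_orbit x t u :
  orbit_rel t u -> orbit_rel (translate x t) (translate x u).
Proof.
elim=> {t u} [t|t u _|t u w _ tu _|s ts us _|e v eS|y z a b zab|y s a] /=.
- exact: Orbit_refl.
- exact: Orbit_sym.
- exact: Orbit_trans.
- exact: Orbit_op.
- have /= evalE := eval_hom (translate_hom x) v.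
  by rewrite !evalE; apply: Orbit_identity.
- by rewrite mulgA; apply: Orbit_act.
- exact: Orbit_gen_op.
Qed.

Section Extension.
Variables (Y : pa_ob G (Al Sigma)) (phi : pa_hom X Y).
Hypothesis Yglobal : global_action (@pa_act _ _ _ Y).

Fixpoint word_ext (t : word_alg) : Y :=
  match t with
  | Gen x a => total_act x (phi a)
  | Node s ts => op (fun i => word_ext (ts i))
  end.

Definition word_ext_hom : alg_hom word_alg Y :=
  @AlgHom T word_alg Y word_ext (fun _ _ => erefl).

Lemma word_ext_translate x t : word_ext (translate x t) = total_act x (word_ext t).
Proof.
elim: t => [y a|s ts IH] /=; first exact: total_actM.
by rewrite total_act_op //; congr op; apply/funext.
Qed.

(** Each clause of [orbit_rel] holds in a global target: the identities because
    the target is in the variety, the last two because [phi] commutes with the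
    partial actions and with the operations, and the total action with the
    operations. *)
Lemma word_ext_orbit t u : orbit_rel t u -> word_ext t = word_ext u.
Proof.
elim=> {t u} [//|//|t u w _ -> //|s ts us _ IH|e v eS|x y a b yab|x s a] /=.
- by congr op; apply/funext.
- have /= evalE := eval_hom word_ext_hom v.
  by rewrite !evalE; exact: (pa_variety Y e eS).
- by rewrite total_actM // /(total_act y _) (pa_homP phi yab).
- by rewrite alg_homP total_act_op.
Qed.

End Extension.

(** The quotient of the words by [orbit_rel], described by a presentation map
    [pi] so that its construction can be forgotten. *)
Lemma globalization_exists :
  exists R : pa_ob G (Al Sigma), global_action (@pa_act _ _ _ R) /\
    exists pi : alg_hom word_alg R,
      [/\ forall q, exists t, pi t = q,
          forall t u, pi t = pi u <-> orbit_rel t u &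
          forall x t, pa_act x (pi t) = Some (pi (translate x t))].
Proof.
have [Q [pi [piS piE]]] := quotient_exists orbit_congruence.
have /choice[act actE] x : exists f : alg_hom Q Q,
    forall t, f (pi t) = pi (translate x t).
  apply: (hom_factor (f := alg_comp pi (translate_hom x))) => // t u /piE tu.
  exact/piE/translate_orbit.
have VQ : Al Sigma Q.
  move=> e eS; apply: (quotient_satisfies piS) => v.
  exact/piE/Orbit_identity.
have act1 q : act 1 q = q.
  by have [t <-] := piS q; rewrite actE translate1.
have actM x y q : act (x * y) q = act x (act y q).
  by have [t <-] := piS q; rewrite !actE translateM.
exists (global_ob VQ act1 actM); split; first exact: global_ob_global.
by exists pi; split=> // x t; rewrite -actE.
Qed.

End Globalization.

(** * The reflection *)

Theorem corollary3p19 (G : groupType) (T : alg_type) (Sigma : identity T -> Prop) :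
  reflective (gA G (Al Sigma)).
Proof.
move=> X; have [R [Rglobal [pi [piS piE piA]]]] := globalization_exists X.
exists R; split=> //.
pose unit_fun (a : X) : R := pi (Gen 1 a).
have unit_op s (a : 'I_(arity s) -> X) :
    unit_fun (op a) = op (fun i => unit_fun (a i)).
  by rewrite -alg_homP; apply/piE/Orbit_sym/Orbit_gen_op.
have unit_act x a b :
    pa_act x a = Some b -> pa_act x (unit_fun a) = Some (unit_fun b).
  move=> xab; rewrite piA; congr Some; apply/piE => /=.
  by rewrite mulg1 -[x in Gen x a]mul1g; apply/Orbit_sym/Orbit_act.
exists (@PaHom _ _ _ X R (AlgHom unit_op) unit_act) => Y Yglobal phi.
have [g gE] : exists g : alg_hom R Y, forall t, g (pi t) = word_ext phi t.
  apply: (hom_factor (f := word_ext_hom phi)) => // t u /piE.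
  exact: word_ext_orbit.
have g_act x q q' : pa_act x q = Some q' -> pa_act x (g q) = Some (g q').
  have [t <-] := piS q; rewrite piA => -[<-].
  by rewrite !gE word_ext_translate // total_actE.
exists (@PaHom _ _ _ R Y g g_act); split.
  split=> //; apply: pa_hom_eq => a /=; rewrite /unit_fun gE /=.
  by rewrite /total_act (pact1 (pa_actP Y)).
move=> psi [_ psiE]; apply: pa_hom_eq => q /=.
have [t <-{q}] := piS q; rewrite gE.
elim: t => [x a|s ts IH] /=; last first.
  by rewrite (alg_homP pi) (alg_homP psi); congr op; apply/funext.
(* The generator [(x, a)] is the translate by [x] of the image of [a]. *)
have /(pa_homP psi) := piA x (Gen 1 a); rewrite /= mulg1.
by rewrite -psiE /= total_actE // => -[].
Qed.
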